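(* Consider the forward PDE system $$\partial_tu(t,x)=\mathscr{F}u(t,x),\quad x\in\Omega\subset\mathbb{R}^n,\ t\ge0,\qquad y(t)=\mathscr{H}u(t,\cdot),\qquad u(0,\cdot)=u_0\in\mathcal{U}_0\subset\mathrm{Dom}(\mathscr{F}),\qquad u\in\mathcal{U}_b,$$ assumed well-posed, with state space $\mathcal{U}$. Given an undesirable set $\mathcal{Y}_u=\{u\in\mathcal{U}\mid\mathscr{H}u\le0\}$ such that $\mathcal{U}_0\cap\mathcal{Y}_u=\emptyset$, suppose there exists a time-independent barrier functional $B(u)$, with $t\mapsto B(u(t,\cdot))$ continuously differentiable along the solutions of the system, such that (i) $B(u)-B(u_0)>0$ for all $u\in\mathcal{Y}_u$ and all $u_0\in\mathcal{U}_0$; (ii) $\dfrac{\mathrm{d}B(u(t,\cdot))}{\mathrm{d}t}\le0$ for all $u\in\mathcal{U}$, along the solutions of the system. Then the solutions of the system avoid $\mathcal{Y}_u$ for all time: every solution $u$ with $u(0,\cdot)\in\mathcal{U}_0$ satisfies $u(t,\cdot)\notin\mathcal{Y}_u$ for all $t\in[0,\infty)$.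
   Context: $\mathcal{U}$ is a Hilbert space of functions on the domain $\Omega\subset\mathbb{R}^n$, the state space of the system; $\mathcal{U}_0\subseteq\mathcal{U}$ is the set of initial conditions; $\mathcal{U}_b$ is the subspace of $\mathcal{U}$ defined by the boundary conditions on $u$; $\mathscr{F}$ is a (possibly nonlinear) operator with domain $\mathrm{Dom}(\mathscr{F})$; $\mathscr{H}:\mathcal{U}\to\mathbb{R}$ is the output map. Well-posedness means that for each admissible initial condition the system has a unique solution $t\mapsto u(t,\cdot)\in\mathcal{U}$. A time-independent barrier functional is a (not necessarily linear) map $B:\mathrm{Dom}(B)\to\mathbb{R}$ with $\mathrm{Dom}(B)\supseteq\mathcal{U}$. ''Along the solutions'' means: evaluated on any solution $t\mapsto u(t,\cdot)$ of the system. *)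

(* Defs.v *)
From HB Require Import structures.
From mathcomp Require Import all_boot all_order all_algebra.
From mathcomp Require Import all_classical all_reals all_analysis.

Set Implicit Arguments.
Unset Strict Implicit.
Unset Printing Implicit Defensive.

Import Order.TTheory GRing.Theory Num.Theory.
Import numFieldNormedType.Exports.

Local Open Scope classical_set_scope.
Local Open Scope ring_scope.

Definition linear_subspace (R : realType) (E : lmodType R) (U : set E) : Prop :=
  U 0 /\ forall (a : R) (u v : E), U u -> U v -> U (a *: u + v).

Definition ip_dist (R : realType) (E : lmodType R) (ip : E -> E -> R)
    (u v : E) : R := Num.sqrt (ip (u - v) (u - v)).

(* The elements of E are functions, not classes of functions, so the inner
   product is only required to be positive semidefinite: u and v represent the
   same vector when ip_dist ip u v = 0. This covers both spaces such as L^2,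
   where functions are identified almost everywhere, and spaces of genuine
   functions, where ip is definite. *)
Record hilbert_space (R : realType) (E : lmodType R) (U : set E)
    (ip : E -> E -> R) : Prop := HilbertSpace {
  hilbert_subspace : linear_subspace U;
  hilbert_sym : forall u v, U u -> U v -> ip u v = ip v u;
  hilbert_linear : forall (a : R) u v w, U u -> U v -> U w ->
    ip (a *: u + v) w = a * ip u w + ip v w;
  hilbert_ge0 : forall u, U u -> 0 <= ip u u;
  hilbert_complete : forall s : nat -> E, (forall k, U (s k)) ->
    (forall e : R, 0 < e -> exists N : nat, forall j k : nat,
      (N <= j)%N -> (N <= k)%N -> ip_dist ip (s j) (s k) < e) ->
    exists2 l, U l & ip_dist ip (s k) l @[k --> \oo] --> (0 : R)
}.

(* Derivatives on the time axis [0, +oo[: two-sided at t > 0, right-sided at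
   t = 0. Values of f at negative times play no role. *)
Definition time_quotient (R : realType) (V : normedModType R) (f : R -> V)
    (t : R) : R -> V := fun h => h^-1 *: (f (t + h) - f t).

Definition time_increments (R : realType) (t : R) : set_system R :=
  within [set h | 0 <= t + h] 0^'.

Definition is_time_derivative (R : realType) (V : normedModType R) (f : R -> V)
    (t : R) (l : V) : Prop :=
  time_quotient f t h @[h --> time_increments t] --> l.

Definition time_derivative (R : realType) (V : normedModType R) (f : R -> V)
    (t : R) : V := lim (time_quotient f t h @[h --> time_increments t]).

Definition time_C1 (R : realType) (V : normedModType R) (f : R -> V) : Prop :=
  (forall t, 0 <= t -> is_time_derivative f t (time_derivative f t)) /\
  {within [set t : R | 0 <= t], continuous (time_derivative f)}.

(* Partial maps are total functions together with their domain; nothing is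
   assumed about, and no definition below uses, their values outside it. *)
Record pde_system (R : realType) (n : nat) (Omega : set 'rV[R]_n)
    (V : normedModType R) := PdeSystem {
  state : set (Omega -> V);
  state_ip : (Omega -> V) -> (Omega -> V) -> R;
  state_hilbert : hilbert_space state state_ip;
  initial : set (Omega -> V);
  boundary : set (Omega -> V);
  operator_dom : set (Omega -> V);
  operator : (Omega -> V) -> (Omega -> V);
  output_map : (Omega -> V) -> R;
  initial_state : initial `<=` state;
  initial_dom : initial `<=` operator_dom;
  boundary_state : boundary `<=` state;
  boundary_subspace : linear_subspace boundary
}.

Section System.
Variables (R : realType) (n : nat) (Omega : set 'rV[R]_n).
Variables (V : normedModType R) (S : pde_system Omega V).

Definition solution_from (u0 : Omega -> V) (u : R -> Omega -> V) : Prop :=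
  [/\ u 0 = u0,
      forall t, 0 <= t ->
        [/\ state S (u t), boundary S (u t) & operator_dom S (u t)]
    & forall t, 0 <= t -> forall x : Omega,
        is_time_derivative (u ^~ x) t (operator S (u t) x)].

Definition solution (u : R -> Omega -> V) : Prop :=
  exists2 u0, initial S u0 & solution_from u0 u.

Definition well_posed : Prop :=
  forall u0, initial S u0 ->
    exists2 u, solution_from u0 u &
      forall v, solution_from u0 v ->
        forall t, 0 <= t -> ip_dist (state_ip S) (u t) (v t) = 0.

Definition system_output (u : R -> Omega -> V) (t : R) : R :=
  output_map S (u t).

Definition undesirable : set (Omega -> V) :=
  [set v | state S v /\ output_map S v <= 0].

End System.

(* Main.v *)
Require Import Defs.
From HB Require Import structures.
From mathcomp Require Import all_boot all_order all_algebra.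
From mathcomp Require Import all_classical all_reals all_analysis.

Set Implicit Arguments.
Unset Strict Implicit.
Unset Printing Implicit Defensive.

Import Order.TTheory GRing.Theory Num.Theory.
Import numFieldNormedType.Exports.

Local Open Scope classical_set_scope.
Local Open Scope ring_scope.

(** Along a solution [u] starting at [u0], the map [t |-> B (u t)] has nonpositive derivative on [0,
    +oo[, so it never exceeds its initial value [B u0]. Any state in the undesirable set has a
    strictly larger value of [B], so [u] cannot reach one. The analytic content is the monotonicity
    lemma [time_derivative_le0_nincr]; the lemmas before it reduce derivatives on the time axis to
    ordinary ones at t > 0 and to right continuity at 0. *)

(** Increments with |h| < t satisfy 0 <= t + h, so away from time 0 the constraint is void near h =
    0. *)
Lemma time_increments_gt0 (R : realType) (t : R) :
  0 < t -> time_increments t = 0^'.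
Proof.
move=> t0; rewrite /time_increments eqEsubset; split=> P; last first.
  exact: cvg_within.
move=> tP; near=> h; have : 0 <= t + h -> P h by near: h; exact: tP.
apply; have : `|h| < t by near: h; exact: dnbhs0_lt.
by rewrite ltr_norml -subr_gt0 opprK addrC => /andP[/ltW].
Unshelve. all: by end_near. Qed.

Lemma time_derivative_gt0 (R : realType) (f : R -> R) (t : R) :
  0 < t -> derive1 f t = time_derivative f t.
Proof.
move=> t0; rewrite /derive1 /time_derivative time_increments_gt0//.
suff -> : time_quotient f t = fun h => h^-1 *: (f (h + t) - f t) by [].
by apply/funext => h; rewrite /time_quotient (addrC t).
Qed.

Lemma is_time_derivative_derivable (R : realType) (f : R -> R) (t l : R) :
  0 < t -> is_time_derivative f t l -> derivable f t 1.
Proof.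
rewrite /is_time_derivative => t0; rewrite time_increments_gt0// => fl.
apply/cvg_ex; exists l; apply: cvg_trans fl; apply: near_eq_cvg.
by near=> h; rewrite /time_quotient /= [h *: 1]mulr1 (addrC h).
Unshelve. all: by end_near. Qed.

(** Supplies continuity at the endpoint 0, where only a right derivative is available. *)
Lemma is_time_derivative_at_right0 (R : realType) (f : R -> R) (l : R) :
  is_time_derivative f 0 l -> f x @[x --> 0^'+] --> f 0.
Proof.
move=> fl.
have ql : time_quotient f 0 h @[h --> 0^'+] --> l.
  (* Every h > 0 is a nonzero admissible increment at time 0. *)
  apply: cvg_trans fl; apply: cvg_fmap2 => P P0.
  have {}P0 : \forall h \near (0 : R), h != 0 -> 0 <= 0 + h -> P h by exact: P0.
  suff : \forall h \near (0 : R), 0 < h -> P h by [].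
  apply: filterS P0 => h + h_gt0; apply.
    by rewrite gt_eqF.
  by rewrite add0r ltW.
(* For h > 0 this expression is exactly [f h]. *)
have : h * time_quotient f 0 h + f 0 @[h --> 0^'+] --> 0 * l + f 0.
  apply: cvgD; last exact: cvg_cst.
  by apply: cvgM ql; apply: cvg_at_right_filter; exact: cvg_id.
rewrite mul0r add0r; apply: cvg_trans; apply: near_eq_cvg; near=> h.
have h0 : h != 0 by rewrite gt_eqF.
by rewrite -[h * _]/(h *: _) scalerA mulfV// scale1r add0r subrK.
Unshelve. all: by end_near. Qed.

(** The mean value argument behind [ler0_derive1_nincry] takes the sign of the derivative on the
    open half-line and continuity on the closed one. *)
Lemma time_derivative_le0_nincr (R : realType) (f : R -> R) :
  (forall t, 0 <= t -> is_time_derivative f t (time_derivative f t)) ->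
  (forall t, 0 <= t -> time_derivative f t <= 0) ->
  forall s t, 0 <= s -> s <= t -> f t <= f s.
Proof.
move=> df df_le0; apply: ler0_derive1_nincry => [x|x|].
- rewrite in_itv/= andbT => x0.
  by apply: (is_time_derivative_derivable x0); exact: (df _ (ltW x0)).
- rewrite in_itv/= andbT => x0.
  by rewrite time_derivative_gt0//; exact: (df_le0 _ (ltW x0)).
- apply/continuous_within_itvcyP; split=> [x|]; last first.
    exact: (is_time_derivative_at_right0 (df 0 (lexx 0))).
  rewrite in_itv/= andbT => x0; apply/differentiable_continuous.
  apply/derivable1_diffP/(is_time_derivative_derivable x0).
  exact: (df _ (ltW x0)).
Qed.

Theorem corollary2 (R : realType) (n : nat) (Omega : set 'rV[R]_n)
    (V : normedModType R) (S : pde_system Omega V)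
    (S_well_posed : well_posed S)
    (init_safe : initial S `&` undesirable S = set0)
    (domB : set (Omega -> V)) (B : (Omega -> V) -> R)
    (state_domB : state S `<=` domB)
    (B_C1 : forall u : R -> Omega -> V,
       solution S u -> time_C1 (fun t => B (u t) : R))
    (B_gap : forall v u0 : Omega -> V,
       undesirable S v -> initial S u0 -> 0 < B v - B u0)
    (B_decr : forall u : R -> Omega -> V, solution S u ->
       forall t : R, 0 <= t -> time_derivative (fun s => B (u s) : R) t <= 0) :
  forall u : R -> Omega -> V, solution S u ->
    forall t : R, 0 <= t -> ~ undesirable S (u t).
Proof.
move=> u solu t t0 ut_bad; have [u0 u0_init [uE _ _]] := solu.
have [dB _] := B_C1 u solu.
have := time_derivative_le0_nincr dB (B_decr u solu) (lexx 0) t0.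
(* Monotonicity between times 0 and t contradicts the gap between [u t] and [u0]. *)
by apply/negP; rewrite -ltNge uE -subr_gt0; exact: B_gap.
Qed.
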